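(* Let $n$ be any positive integer and let $S=\mathscr{IO}_{\infty}(\mathbb{Z}^n_{\mathrm{lex}})$. Then the following assertions hold: (i) An element $\alpha\in S$ is an idempotent if and only if $(x)\alpha=x$ for every $x\in\operatorname{dom}\alpha$. (ii) If $\varepsilon,\iota\in E(S)$, then $\varepsilon\leqslant\iota$ if and only if $\operatorname{dom}\varepsilon\subseteq\operatorname{dom}\iota$. (iii) The semilattice $E(S)$ is isomorphic to $(\mathscr{P}_{<\omega}(L_n\times\mathbb{Z}),\subseteq)$ under the mapping $(\varepsilon)h=(L_n\times\mathbb{Z})\setminus\operatorname{dom}\varepsilon$. (iv) Every maximal chain in $E(S)$ is an $\omega$-chain. (v) $\alpha\mathscr{R}\beta$ in $S$ if and only if $\operatorname{dom}\alpha=\operatorname{dom}\beta$. (vi) $\alpha\mathscr{L}\beta$ in $S$ if and only if $\operatorname{ran}\alpha=\operatorname{ran}\beta$. (vii) $\alpha\mathscr{H}\beta$ in $S$ if and only if $\operatorname{dom}\alpha=\operatorname{dom}\beta$ and $\operatorname{ran}\alpha=\operatorname{ran}\beta$. (viii) For all idempotents $\varepsilon,\varphi\in S$ there exist infinitely many elements $\alpha,\beta\in S$ such that $\alpha\cdot\beta=\varepsilon$ and $\beta\cdot\alpha=\varphi$. (ix) $S$ is a bisimple semigroup, and hence $\mathscr{J}=\mathscr{D}$ on $S$.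
   Context: $L_n=\{1,\ldots,n\}$ with its usual order; $L_n\times_{\mathrm{lex}}\mathbb{Z}$ is $L_n\times\mathbb{Z}$ with the lexicographic order: $(i,m)\leqslant(j,l)$ iff $i<j$, or $i=j$ and $m\le l$. $\mathscr{IO}_{\infty}(\mathbb{Z}^n_{\mathrm{lex}})$ is the set of all injective partial maps $\alpha$ from $L_n\times\mathbb{Z}$ to itself that are monotone ($x\leqslant y$ in $\operatorname{dom}\alpha$ implies $(x)\alpha\leqslant(y)\alpha$) and such that both $\operatorname{dom}\alpha$ and the image $\operatorname{ran}\alpha$ have finite complement in $L_n\times\mathbb{Z}$. The operation is composition of partial maps written on the right: $(x)(\alpha\beta)=((x)\alpha)\beta$, with $\operatorname{dom}(\alpha\beta)=\{x\in\operatorname{dom}\alpha : (x)\alpha\in\operatorname{dom}\beta\}$. It is an inverse monoid (a submonoid of the symmetric inverse monoid on $L_n\times\mathbb{Z}$). $E(S)$ is the set of idempotents of $S$, with natural partial order $e\leqslant f$ iff $ef=fe=e$. $(\mathscr{P}_{<\omega}(X),\subseteq)$ is the set of all finite subsets of $X$ (including the empty set) with the semilattice operation union. A chain in a semilattice is a linearly ordered subset; a maximal chain is one not properly contained in another chain; an $\omega$-chain is a chain order isomorphic to $\{0,-1,-2,-3,\ldots\}$ with the usual order. $\mathscr{R},\mathscr{L},\mathscr{H},\mathscr{D},\mathscr{J}$ are Green's relations ($a\mathscr{R}b$ iff $aS^1=bS^1$; $a\mathscr{L}b$ iff $S^1a=S^1b$; $a\mathscr{J}b$ iff $S^1aS^1=S^1bS^1$;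 $\mathscr{D}=\mathscr{L}\circ\mathscr{R}$; $\mathscr{H}=\mathscr{L}\cap\mathscr{R}$). A semigroup is bisimple if it has a unique $\mathscr{D}$-class. *)

(* Defs.v *)
From HB Require Import structures.
From mathcomp Require Import all_boot all_order all_algebra.
From mathcomp Require Import boolp classical_sets functions cardinality.

Set Implicit Arguments.
Unset Strict Implicit.
Unset Printing Implicit Defensive.

Import Order.TTheory GRing.Theory Num.Theory.
Local Open Scope group_scope.
Local Open Scope classical_set_scope.

Section PartialMaps.
Context {T : Type}.
Implicit Types f g : T -> option T.

Definition dom f : set T := [set x | exists y, f x = Some y].
Definition ran f : set T := [set y | exists x, f x = Some y].

Definition pinjective f : Prop :=
  forall x y z, f x = Some z -> f y = Some z -> x = y.

End PartialMaps.

Section Monotone.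
Context {d : Order.disp_t} {T : porderType d}.
Implicit Types f g : T -> option T.

Definition pmonotone f : Prop :=
  forall x y u v, f x = Some u -> f y = Some v -> (x <= y)%O -> (u <= v)%O.

Definition cofinite_monotone f : Prop :=
  [/\ pinjective f, pmonotone f,
      finite_set (~` dom f) & finite_set (~` ran f)].

Lemma cofinite_monotone_id : cofinite_monotone (fun x => Some x).
Proof.
split.
- by move=> x y z [->] [->].
- by move=> x y u v [->] [->].
- by apply: (sub_finite_set _ (finite_set0 T)) => x; apply; exists x.
- by apply: (sub_finite_set _ (finite_set0 T)) => x; apply; exists x.
Qed.

(* [pcomp g f] applies [f] first. *)
Lemma cofinite_monotone_comp f g :
  cofinite_monotone f -> cofinite_monotone g -> cofinite_monotone (pcomp g f).
Proof.
move=> [fi fm fd fr] [gi gm gd gr].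
have compE x z : pcomp g f x = Some z -> exists2 y, f x = Some y & g y = Some z.
  by rewrite /pcomp; case: (f x) => //= y gy; exists y.
split.
- move=> x y z /compE[u fx gu] /compE[v fy gv].
  by apply: fi fx _; rewrite fy (gi _ _ _ gu gv).
- move=> x y u v /compE[x' fx gx] /compE[y' fy gy] xy.
  exact: gm gx gy (fm _ _ _ _ fx fy xy).
- have fin : finite_set (f @^-1` (some @` ~` dom g)).
    apply: finite_preimage; last exact: finite_image.
    move=> x y; rewrite !inE => -[u _ fx] [v _ fy] fxy.
    by apply: fi (esym fx) _; rewrite -fxy.
  apply: (sub_finite_set _ (B := ~` dom f `|` (f @^-1` (some @` ~` dom g)))).
    move=> x ndom; case fx: (f x) => [y|]; last by left => -[y]; rewrite fx.
    right; exists y; last by rewrite fx.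
    by move=> [z gy]; apply: ndom; exists z; rewrite /pcomp fx.
  by rewrite finite_setU.
- have fin : finite_set (some @^-1` (g @` ~` ran f)).
    apply: finite_preimage; last exact: finite_image.
    by move=> x y _ _ [].
  apply: (sub_finite_set _ (B := ~` ran g `|` (some @^-1` (g @` ~` ran f)))).
    move=> z nran; have [[y gy]|] := pselect (ran g z); last by left.
    right; exists y => // -[x fx]; apply: nran; exists x.
    by rewrite /pcomp fx.
  by rewrite finite_setU.
Qed.

End Monotone.

Record IO_infty d (T : porderType d) := MkIO {
  IO_fun :> T -> option T;
  IO_funP : cofinite_monotone IO_fun }.

Section Monoid.
Context {d : Order.disp_t} {T : porderType d}.
Implicit Types a b c : IO_infty T.

Lemma IO_eq a b : (forall x, a x = b x) -> a = b.
Proof.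
case: a b => [f fP] [g gP] /= /funext fg; rewrite fg in fP *.
by rewrite (Prop_irrelevance fP gP).
Qed.

HB.instance Definition _ := gen_eqMixin (IO_infty T).
HB.instance Definition _ := gen_choiceMixin (IO_infty T).

Definition IO_one : IO_infty T := MkIO cofinite_monotone_id.

(* Maps are written on the right: [(x)(ab) = ((x)a)b]. *)
Definition IO_mul a b : IO_infty T :=
  MkIO (cofinite_monotone_comp (IO_funP a) (IO_funP b)).

Lemma IO_mulA : associative IO_mul.
Proof. by move=> a b c; apply: IO_eq => x; rewrite /= /pcomp; case: (a x). Qed.

Lemma IO_mul1l : left_id IO_one IO_mul.
Proof. by move=> a; apply: IO_eq. Qed.

Lemma IO_mul1r : right_id IO_one IO_mul.
Proof. by move=> a; apply: IO_eq => x; rewrite /= /pcomp; case: (a x). Qed.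

HB.instance Definition _ := isMonoid.Build (IO_infty T) IO_mulA IO_mul1l IO_mul1r.

End Monoid.

(* [L_n x Z]; the factor [L_n] is ['I_n], i.e. indexed from 0. *)
Definition LnZ (n : nat) := ('I_n *l int)%type.

Notation IOZlex n := (IO_infty (LnZ n : porderType _)).

Section Green.
Context {S : semigroupType}.
Implicit Types (a b c s e f : S) (K C : set S).

(* In [option S], [None] plays the role of the identity of [S^1]. *)
Definition mulr1 a (u : option S) : S := if u is Some s then a * s else a.
Definition mull1 (u : option S) a : S := if u is Some s then s * a else a.

Definition right_ideal1 a : set S := [set mulr1 a u | u in setT].
Definition left_ideal1 a : set S := [set mull1 u a | u in setT].
Definition ideal1 a : set S :=
  [set b | exists u v : option S, b = mulr1 (mull1 u a) v].

Definition greenR a b : Prop := right_ideal1 a = right_ideal1 b.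
Definition greenL a b : Prop := left_ideal1 a = left_ideal1 b.
Definition greenJ a b : Prop := ideal1 a = ideal1 b.
Definition greenH a b : Prop := greenL a b /\ greenR a b.
Definition greenD a b : Prop := exists2 c, greenL a c & greenR c b.

Definition is_Dclass K : Prop := exists a, K = [set b | greenD a b].

End Green.

Definition bisimple (S : semigroupType) : Prop :=
  exists! K : set S, is_Dclass K.

Section Idempotents.
Context {S : semigroupType}.
Implicit Types (e f : S) (C D : set S).

Definition idempotents : set S := [set e | e * e = e].

Definition idem_le e f : Prop := e * f = e /\ f * e = e.

Definition is_chain C : Prop := C `<=` idempotents /\ total_on C idem_le.

Definition is_maximal_chain C : Prop :=
  is_chain C /\ forall D, is_chain D -> C `<=` D -> D = C.

Definition is_omega_chain C : Prop :=
  is_chain C /\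
  exists2 g : int -> S,
    set_bij [set k : int | (k <= 0)%R] C g &
    forall k l : int, (k <= 0)%R -> (l <= 0)%R ->
      ((k <= l)%R <-> idem_le (g k) (g l)).

End Idempotents.

Arguments idempotents S : clear implicits.

Definition is_semilattice (U : Type) (A : set U) (op : U -> U -> U) : Prop :=
  [/\ forall x y, A x -> A y -> A (op x y),
      forall x y z, A x -> A y -> A z -> op x (op y z) = op (op x y) z,
      forall x y, A x -> A y -> op x y = op y x
    & forall x, A x -> op x x = x].

Definition semilattice_iso (U V : Type) (A : set U) (opA : U -> U -> U)
    (B : set V) (opB : V -> V -> V) (h : U -> V) : Prop :=
  [/\ is_semilattice A opA, is_semilattice B opB, set_bij A B h
    & forall x y, A x -> A y -> h (opA x y) = opB (h x) (h y)].

(* Main.v *)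
(** Idempotents are the partial identities with cofinite domain, which gives the
    claims on [E(S)]; in a maximal chain each corank (the cardinality of the
    complement of the domain) occurs exactly once. Since the order is total, the
    inverse of an element is again monotone, so the principal one-sided ideals
    are determined by the inclusion of domains, resp. of ranges. Removing a point
    [(i, m)] and moving [(i, l)], [m < l], to [(i, l - 1)] maps onto everything;
    iterating, every cofinite set is the domain of an element with full range,
    whence bisimplicity. If [p], [q] are such elements with domains [dom e] and
    [dom f], then [p u q^-1] and [q u^-1 p^-1] factor [e] and [f] for each of the
    infinitely many shifts [u]. *)
Require Import Defs.
From HB Require Import structures.
From mathcomp Require Import all_boot all_order all_algebra.
From mathcomp Require Import finmap.
From mathcomp Require Import boolp classical_sets functions cardinality.
From mathcomp Require Import zify.

Set Implicit Arguments.
Unset Strict Implicit.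
Unset Printing Implicit Defensive.

Import Order.TTheory.
Local Open Scope group_scope.
Local Open Scope classical_set_scope.

(** * Green's relations in arbitrary semigroups and monoids *)

Section Semigroup.
Context {S : semigroupType}.
Implicit Types a b : S.

Lemma greenL_J a b : greenL a b -> greenJ a b.
Proof.
suff sub (x y : S) : left_ideal1 x = left_ideal1 y -> ideal1 x `<=` ideal1 y.
  by move=> ab; apply/seteqP; split; apply: sub.
move=> xy c [u [v ->]].
have [w _ <-] : left_ideal1 y (mull1 u x) by rewrite -xy; exists u.
by exists w, v.
Qed.

Lemma mull1_mulr1 u a v : mull1 u (mulr1 a v) = mulr1 (mull1 u a) v.
Proof. by case: u v => [u|] [v|] //=; rewrite mulgA. Qed.

Lemma greenR_J a b : greenR a b -> greenJ a b.
Proof.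
suff sub (x y : S) : right_ideal1 x = right_ideal1 y -> ideal1 x `<=` ideal1 y.
  by move=> ab; apply/seteqP; split; apply: sub.
move=> xy c [u [v ->]]; rewrite -mull1_mulr1.
have [w _ <-] : right_ideal1 y (mulr1 x v) by rewrite -xy; exists v.
by exists u, w; rewrite mull1_mulr1.
Qed.

(** Both one-sided relations refine [greenJ], and [greenJ] is transitive. *)
Lemma greenD_J a b : greenD a b -> greenJ a b.
Proof. by move=> [c /greenL_J ac /greenR_J cb]; rewrite /greenJ ac. Qed.

(** Every class is the whole of [S]; the element [a] ensures that there is a class at all. *)
Lemma greenD_total_bisimple a : (forall b c : S, greenD b c) -> bisimple S.
Proof.
move=> D; have DT b : [set c | greenD b c] = setT.
  by apply/seteqP; split=> // c _; exact: D.
exists setT; split=> [|K [b ->]]; last by rewrite DT.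
by exists a; rewrite DT.
Qed.

End Semigroup.

Section Monoid.
Context {S : monoidType}.
Implicit Types a c : S.

Lemma right_ideal1P a c : right_ideal1 a c <-> exists s, c = a * s.
Proof.
split=> [[[s|] _ <-]|[s ->]]; [by exists s|by exists 1; rewrite mulg1|].
by exists (Some s).
Qed.

Lemma left_ideal1P a c : left_ideal1 a c <-> exists s, c = s * a.
Proof.
split=> [[[s|] _ <-]|[s ->]]; [by exists s|by exists 1; rewrite mul1g|].
by exists (Some s).
Qed.

End Monoid.

(** * Idempotents as partial identities, over any partial order *)

Section PartialOrder.
Context {d : Order.disp_t} {T : porderType d}.
Implicit Types (a b e f : IO_infty T) (A : set T).

Lemma IO_mulE a b x : (a * b) x = obind b (a x).
Proof. by []. Qed.

Lemma IO_mul_Some a b x y : a x = Some y -> (a * b) x = b y.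
Proof. by rewrite IO_mulE => ->. Qed.

Lemma IO_None a x : ~ dom a x -> a x = None.
Proof. by case ax: (a x) => [y|] // []; exists y. Qed.

Lemma dom_IO a : finite_set (~` dom a).
Proof. by case: (IO_funP a). Qed.

(** If an idempotent [a] sends [x] to [y], then it fixes [y], so injectivity forces [x = y]. *)
Lemma idempotentP a :
  idempotents (IO_infty T) a <-> (forall x, dom a x -> a x = Some x).
Proof.
split=> [aa x [y axy]|aid]; last first.
  apply: IO_eq => x; rewrite IO_mulE; case axy: (a x) => [y|] //=.
  have := axy; rewrite aid; last by exists y.
  by move=> [<-]; rewrite aid //; exists y.
have ayy : a y = Some y by rewrite -[RHS]axy -[in RHS]aa IO_mulE axy.
have [inj _ _ _] := IO_funP a.
by rewrite axy (inj x y y).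
Qed.

Lemma idem_dom_le e f : idempotents (IO_infty T) e ->
  idempotents (IO_infty T) f -> (idem_le e f <-> dom e `<=` dom f).
Proof.
move=> /idempotentP eP /idempotentP fP; split=> [[_ <-] x [y]|sub].
  by rewrite IO_mulE; case fx: (f x) => [z|] //= _; exists z.
have ef x : dom e x -> e x = Some x /\ f x = Some x.
  by move=> ex; split; [exact: eP|exact/fP/sub].
split; apply: IO_eq => x; rewrite IO_mulE.
  by have [/ef[-> /= ->]|/IO_None ->] := pselect (dom e x).
have [/ef[ex fx]|nex] := pselect (dom e x); first by rewrite fx.
have [/fP -> //|/IO_None ->] := pselect (dom f x).
by rewrite IO_None.
Qed.

Lemma idem_eq e f : idempotents (IO_infty T) e ->
  idempotents (IO_infty T) f -> dom e = dom f -> e = f.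
Proof.
move=> ie jf ef.
have [|<- _] := (idem_dom_le ie jf).2; first by rewrite ef.
by have [|_ ->] := (idem_dom_le jf ie).2; first by rewrite ef.
Qed.

Lemma dom_idem_mul e f : idempotents (IO_infty T) e ->
  dom (e * f) = dom e `&` dom f.
Proof.
move=> /idempotentP eP; apply/seteqP; split=> [x [y]|x [ex [y fx]]].
  rewrite IO_mulE; case ex: (e x) => [z|] //= fz.
  have dx : dom e x by exists z.
  by split=> //; exists y; move: ex; rewrite eP // => -[->].
by exists y; rewrite IO_mulE eP.
Qed.

Lemma idem_mul e f : idempotents (IO_infty T) e ->
  idempotents (IO_infty T) f -> idempotents (IO_infty T) (e * f).
Proof.
move=> ie jf; apply/idempotentP => x; rewrite dom_idem_mul // => -[ex fx].
by rewrite IO_mulE (idempotentP e).1 //= (idempotentP f).1.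
Qed.

Lemma idem_mulC e f : idempotents (IO_infty T) e ->
  idempotents (IO_infty T) f -> e * f = f * e.
Proof.
move=> ie jf; apply: idem_eq; try exact: idem_mul.
by rewrite !dom_idem_mul // setIC.
Qed.

Definition pid A (x : T) : option T := if `[< A x >] then Some x else None.

Lemma pidE A x y : pid A x = Some y <-> A x /\ x = y.
Proof.
rewrite /pid; case: asboolP => Ax; last by split=> // -[].
by split=> [[]|[_ ->]].
Qed.

Lemma dom_pid A : dom (pid A) = A.
Proof.
by apply/seteqP; split=> [x [y /pidE[]]|x Ax]; last by exists x; apply/pidE.
Qed.

Lemma ran_pid A : ran (pid A) = A.
Proof.
apply/seteqP; split=> [x [y /pidE[Ay <-]]//|x Ax].
by exists x; apply/pidE.
Qed.

Lemma cofinite_monotone_pid A : finite_set (~` A) -> cofinite_monotone (pid A).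
Proof.
move=> fA; split; rewrite ?dom_pid ?ran_pid //.
  by move=> x y z /pidE[_ ->] /pidE[].
by move=> x y u v /pidE[_ <-] /pidE[_ <-].
Qed.

Lemma idem_exists A : finite_set (~` A) ->
  exists2 e, idempotents (IO_infty T) e & dom e = A.
Proof.
move=> fA; have domA := dom_pid A.
exists (MkIO (cofinite_monotone_pid fA)) => //.
by apply/idempotentP => x; rewrite /= domA => Ax; apply/pidE.
Qed.

Lemma idempotents_iso :
  semilattice_iso (idempotents (IO_infty T)) (fun e f => e * f)
    [set A : set T | finite_set A] (fun A B => A `|` B) (fun e => ~` dom e).
Proof.
split.
- split=> //; [exact: idem_mul|by move=> *; rewrite mulgA|exact: idem_mulC].
- split=> [A B fA fB|A B C|A B|A] *; rewrite ?setUA ?setUid //=.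
    by rewrite finite_setU.
  by rewrite setUC.
- split=> [e _|e f /set_mem ie /set_mem jf /= ef|A fA]; first exact: dom_IO.
    by apply: idem_eq => //; apply: setC_inj.
  have [|e ie de] := @idem_exists (~` A); first by rewrite setCK.
  by exists e; rewrite // de setCK.
- by move=> e f ie jf /=; rewrite dom_idem_mul // setCI.
Qed.

End PartialOrder.

(** * Inverses and the one-sided Green's relations, over a total order *)

Section TotalOrder.
Context {d : Order.disp_t} {T : orderType d}.
Implicit Types (a b c : IO_infty T) (f : T -> option T).

(** The preimage is picked by choice; it is unique when [f] is injective, which makes this the
    inverse partial map. *)
Definition pinv f (y : T) : option T :=
  if pselect (exists x, f x = Some y) is left h then Some (sval (cid h))
  else None.

Lemma pinvE f : pinjective f -> forall x y, pinv f y = Some x <-> f x = Some y.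
Proof.
move=> inj x y; rewrite /pinv; case: pselect => [h|nh]; last first.
  by split=> // fx; case: nh; exists x.
case: cid => z fz /=; split=> [[<-]//|fx].
by rewrite (inj _ _ _ fz fx).
Qed.

(** Monotonicity uses totality: if preimages [u], [v] of [x <= y] had [v < u], then monotonicity of
    [f] would give [y <= x], hence [x = y] and [u = v]. *)
Lemma cofinite_monotone_pinv f : cofinite_monotone f -> cofinite_monotone (pinv f).
Proof.
move=> [inj mon fd fr]; have E := pinvE inj; split.
- by move=> x y z /E fx /E; rewrite fx => -[].
- move=> x y u v /E fu /E fv xy; rewrite leNgt; apply/negP => vu.
  have yx := mon _ _ _ _ fv fu (ltW vu).
  have exy : x = y by apply/le_anti; rewrite xy.
  by move: vu; rewrite (inj u v y) ?ltxx // -exy.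
- apply: sub_finite_set fr => y ny [x fx]; apply: ny; exists x; exact/E.
- apply: sub_finite_set fd => y ny [x fx]; apply: ny; exists x; exact/E.
Qed.

Definition IO_inv a : IO_infty T := MkIO (cofinite_monotone_pinv (IO_funP a)).

Lemma IO_invE a x y : IO_inv a y = Some x <-> a x = Some y.
Proof. by apply: pinvE; case: (IO_funP a). Qed.

Lemma dom_IO_inv a : dom (IO_inv a) = ran a.
Proof. by apply/seteqP; split=> y [x] /IO_invE; exists x. Qed.

Lemma ran_IO_inv a : ran (IO_inv a) = dom a.
Proof. by apply/seteqP; split=> y [x] /IO_invE; exists x. Qed.

(** The product [a * IO_inv a] is the partial identity on [dom a], so it acts trivially on the left
    of [b]. *)
Lemma mulVg_dom a b : dom b `<=` dom a -> a * (IO_inv a * b) = b.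
Proof.
move=> sub; apply: IO_eq => x.
have [/sub[z az]|nbx] := pselect (dom b x).
  by rewrite (IO_mul_Some _ az) (IO_mul_Some _ ((IO_invE a x z).2 az)).
rewrite (IO_None nbx) IO_mulE; case az: (a x) => [z|] //.
rewrite [LHS](IO_mul_Some _ ((IO_invE a x z).2 az)).
exact: IO_None.
Qed.

Lemma mulVg_ran a b : ran b `<=` ran a -> b * IO_inv a * a = b.
Proof.
move=> sub; apply: IO_eq => x; rewrite -mulgA.
case bx: (b x) => [y|]; last by rewrite IO_mulE bx.
have [|z az] := sub y; first by exists x.
by rewrite (IO_mul_Some _ bx) (IO_mul_Some _ ((IO_invE a z y).2 az)).
Qed.

Lemma dom_mul_sub a b : dom (a * b) `<=` dom a.
Proof. by move=> x [y]; rewrite IO_mulE; case ax: (a x) => [z|]//; exists z. Qed.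

Lemma ran_mul_sub a b : ran (a * b) `<=` ran b.
Proof. by move=> y [x]; rewrite IO_mulE; case ax: (a x) => [z|]//; exists z. Qed.

Lemma right_ideal1_dom a c : right_ideal1 a c <-> dom c `<=` dom a.
Proof.
split=> [/right_ideal1P[s ->]|sub]; first exact: dom_mul_sub.
by apply/right_ideal1P; exists (IO_inv a * c); rewrite mulVg_dom.
Qed.

Lemma left_ideal1_ran a c : left_ideal1 a c <-> ran c `<=` ran a.
Proof.
split=> [/left_ideal1P[s ->]|sub]; first exact: ran_mul_sub.
by apply/left_ideal1P; exists (c * IO_inv a); rewrite mulVg_ran.
Qed.

Lemma greenR_dom a b : greenR a b <-> dom a = dom b.
Proof.
split=> [ab|ab]; apply/seteqP; split.
- by apply/right_ideal1_dom; rewrite -ab; apply/right_ideal1_dom.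
- by apply/right_ideal1_dom; rewrite ab; apply/right_ideal1_dom.
- by move=> c /right_ideal1_dom; rewrite ab => /right_ideal1_dom.
- by move=> c /right_ideal1_dom; rewrite -ab => /right_ideal1_dom.
Qed.

Lemma greenL_ran a b : greenL a b <-> ran a = ran b.
Proof.
split=> [ab|ab]; apply/seteqP; split.
- by apply/left_ideal1_ran; rewrite -ab; apply/left_ideal1_ran.
- by apply/left_ideal1_ran; rewrite ab; apply/left_ideal1_ran.
- by move=> c /left_ideal1_ran; rewrite ab => /left_ideal1_ran.
- by move=> c /left_ideal1_ran; rewrite -ab => /left_ideal1_ran.
Qed.

Lemma greenH_dom_ran a b : greenH a b <-> dom a = dom b /\ ran a = ran b.
Proof.
by split=> -[]; [move=> /greenL_ran ? /greenR_dom ?|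
  move=> /greenR_dom ? /greenL_ran ?]; split.
Qed.

Lemma dom_mulV a : dom (a * IO_inv a) = dom a.
Proof.
apply/seteqP; split=> [|x [y ax]]; first exact: dom_mul_sub.
by exists x; rewrite (IO_mul_Some _ ax); apply/IO_invE.
Qed.

Lemma dom_mul_full a b : dom b = setT -> dom (a * b) = dom a.
Proof.
move=> bT; apply/seteqP; split=> [|x [y ax]]; first exact: dom_mul_sub.
have [z bz] : dom b y by rewrite bT.
by exists z; rewrite IO_mulE ax.
Qed.

Lemma ran_mul_full a b : ran a = setT -> ran (a * b) = ran b.
Proof.
move=> aT; apply/seteqP; split=> [|y [x bx]]; first exact: ran_mul_sub.
have [z az] : ran a x by rewrite aT.
by exists z; rewrite IO_mulE az.
Qed.

End TotalOrder.

Lemma injective_infinite_set {U : Type} (g : nat -> U) (A : set U) :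
  injective g -> (forall k, A (g k)) -> infinite_set A.
Proof.
move=> g_inj gA fA; apply: infinite_nat.
have fin : finite_set (g @^-1` A).
  by apply: finite_preimage => // x y _ _; apply: g_inj.
by apply: sub_finite_set fin => k _; apply: gA.
Qed.

(** * Maximal chains of idempotents, measured by corank *)

Section MaximalChains.
Context {d : Order.disp_t} {T : porderType d}.
Implicit Types (e f : IO_infty T) (C : set (IO_infty T)).

Definition corank e : nat := #|` fset_set (~` dom e)|%fset.

Lemma corank_le e f : idempotents (IO_infty T) e ->
  idempotents (IO_infty T) f -> idem_le e f -> (corank f <= corank e)%N.
Proof.
move=> ie jf /(idem_dom_le ie jf) /subsetC.
by rewrite (fset_set_sub (dom_IO f) (dom_IO e)) => /fsubset_leq_card.
Qed.

Lemma corank_inj e f : idempotents (IO_infty T) e ->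
  idempotents (IO_infty T) f -> idem_le e f -> corank e = corank f -> e = f.
Proof.
move=> ie jf /(idem_dom_le ie jf) /subsetC.
rewrite (fset_set_sub (dom_IO f) (dom_IO e)) => sub ef; apply: idem_eq => //.
apply: setC_inj; apply: (fset_set_inj (dom_IO e) (dom_IO f)).
by apply: esym; apply/eqP; rewrite eqEfcard sub -/(corank e) ef leqnn.
Qed.

(** Comparable idempotents of equal corank coincide, so corank reverses and reflects the order of a
    chain. *)
Lemma chain_corank C e f : is_chain C -> C e -> C f ->
  (corank f <= corank e)%N <-> idem_le e f.
Proof.
move=> [idC totC] Ce Cf; split; last by apply: corank_le; exact: idC.
have [//|fe ef] := totC e f Ce Cf.
rewrite (corank_inj (idC _ Cf) (idC _ Ce) fe); first by split; exact: idC.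
by apply/eqP; rewrite eqn_leq ef (corank_le (idC _ Cf) (idC _ Ce) fe).
Qed.

Lemma maximal_chain_mem C e : is_maximal_chain C ->
  idempotents (IO_infty T) e ->
  (forall f, C f -> idem_le e f \/ idem_le f e) -> C e.
Proof.
move=> [[idC totC] maxC] ie cmp.
have <- : e |` C = C; last by left.
apply: maxC => [|f Cf]; last by right.
split=> [f [->//|/idC//]|f g [->|Cf] [->|Cg]]; [by left|exact: cmp| |exact: totC].
by have [|] := cmp f Cf; [right|left].
Qed.

(** Induction on [k], starting from the identity. The step deletes from [dom e] one point, chosen so
    that the new idempotent is comparable with all of [C]; maximality then puts it in [C]. *)
Lemma maximal_chain_corank C k : infinite_set [set: T] ->
  is_maximal_chain C -> exists e, C e /\ corank e = k.
Proof.
move=> infT maxC; have [chC _] := maxC; have [idC totC] := chC.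
elim: k => [|k [e [Ce ek]]].
  have dom1 : dom (1 : IO_infty T) = setT.
    by apply/seteqP; split=> // x _; exists x.
  have i1 : idempotents (IO_infty T) 1 by rewrite /idempotents /= mulg1.
  exists 1; split; last by rewrite /corank dom1 setCT fset_set0 cardfs0.
  by apply: maximal_chain_mem => // f Cf; right; split; rewrite ?mul1g ?mulg1.
(* [x] lies outside the domain of the next smaller element of [C], if any. *)
have [x ex xP] : exists2 x, dom e x & forall f, C f -> idem_le e f \/ ~ dom f x.
  (* The least corank [m] above [k] attained in [C] belongs to the next element below [e]. *)
  have [h|h] := pselect (exists m, `[< exists f, C f /\ corank f = m >] && (k < m)%N).
    case: (ex_minnP h) => m /andP[/asboolP[f [Cf fm]] km] min.
    have : ~ dom e `<=` dom f.
      move=> /(idem_dom_le (idC _ Ce) (idC _ Cf)) /(corank_le (idC _ Ce) (idC _ Cf)).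
      by rewrite ek fm leqNgt km.
    move=> /existsNP[x /not_implyP[ex nfx]]; exists x => // g Cg.
    have [gk|kg] := leqP (corank g) k.
      by left; apply/(chain_corank chC) => //; rewrite ek.
    right=> gx; apply: nfx; move: x gx {ex}.
    apply/(idem_dom_le (idC _ Cg) (idC _ Cf))/(chain_corank chC) => //.
    by rewrite fm; apply: min; rewrite kg andbT; apply/asboolP; exists g.
  (* Here every member of [C] has corank at most [k], hence lies above [e], and any point of the
     infinite set [dom e] will do. *)
  have [x ex] : dom e !=set0.
    apply: infinite_setN0; apply: cofinite_set_infinite => //; exact: dom_IO.
  exists x => // f Cf; left; apply/(chain_corank chC) => //; rewrite ek leqNgt.
  apply/negP => kf; apply: h; exists (corank f); rewrite kf andbT.
  by apply/asboolP; exists f.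
have domC : ~` (dom e `\ x) = x |` ~` dom e by rewrite setCD setUC.
have [|e' ie' de'] := @idem_exists _ _ (dom e `\ x).
  by rewrite domC finite_setU; split; [exact: finite_set1|exact: dom_IO].
exists e'; split; last first.
  rewrite /corank de' domC fset_setU1; last exact: dom_IO.
  have -> : #|` x |` fset_set (~` dom e)|%fset = (corank e).+1; last by rewrite ek.
  rewrite cardfsU1; case: (boolP (x \in _)) => //=.
  by rewrite in_fset_set ?inE //; exact: dom_IO.
apply: maximal_chain_mem => // f Cf; have jf := idC _ Cf; have ie := idC _ Ce.
have [/(idem_dom_le ie jf) ef|nfx] := xP f Cf.
  by left; apply/idem_dom_le => //; rewrite de' => y [/ef].
have [/(idem_dom_le ie jf) ef|/(idem_dom_le jf ie) fe] := totC e f Ce Cf.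
  by case: nfx; apply: ef.
right; apply/idem_dom_le => //; rewrite de' => y fy; split; first exact: fe.
by move=> yx; apply: nfx; rewrite -yx.
Qed.

Lemma maximal_chain_omega C : infinite_set [set: T] ->
  is_maximal_chain C -> is_omega_chain C.
Proof.
move=> infT maxC; have [chC _] := maxC; have [idC totC] := chC.
have [g gP] := choice (fun k => maximal_chain_corank k infT maxC).
have Cg k : C (g k) by case: (gP k).
have gk k : corank (g k) = k by case: (gP k).
(* The element of corank [-k] is placed at [k <= 0], so smaller integers give smaller
   idempotents. *)
split=> //; exists (fun k : int => g `|k|%N).
  split=> [k _|k l /set_mem /= k0 /set_mem /= l0 /(congr1 corank)|f Cf].
  - exact: Cg.
  - by rewrite !gk; lia.
  - exists (- (corank f)%:Z)%R => /=; first by lia.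
    have -> : `|(- (corank f)%:Z)%R|%N = corank f by lia.
    have := (chain_corank chC (Cg (corank f)) Cf).1.
    by rewrite gk => /(_ (leqnn _)) /corank_inj -> //; exact: idC.
move=> k l k0 l0; rewrite -(chain_corank chC) // !gk.
by split; lia.
Qed.

End MaximalChains.

(** * Maps onto the whole order: universality of [greenD] and factorizations of idempotents *)

Section Expansion.
Context {d : Order.disp_t} {T : orderType d}.
Implicit Types (a b e f : IO_infty T) (A : set T).

Definition has_full_ranges : Prop := forall A, finite_set (~` A) ->
  exists a : IO_infty T, dom a = A /\ ran a = setT.

(** Induction on the finite complement [X]. To delete a further point [x] after [a] has deleted [X],
    compose [a] with a map deleting the image of [x] under [a]. *)
Lemma remove_points_full_ranges :
  (forall x : T, exists a : IO_infty T, dom a = ~` [set x] /\ ran a = setT) ->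
  has_full_ranges.
Proof.
move=> rm A /finite_fsetP[X AX]; rewrite -[A]setCK AX {A AX}.
elim/fset1U_rect: X => [|x X xX [a [da ra]]].
  exists 1; split; apply/seteqP; split=> // x _; last by exists x.
  by exists x.
have [y axy] : dom a x by rewrite da /=; apply/negP.
have [b [db rb]] := rm y.
exists (a * b); split; last by rewrite ran_mul_full.
have [a_inj _ _ _] := IO_funP a.
apply/seteqP; split=> [z [u]|z].
  rewrite IO_mulE; case az: (a z) => [w|] //= bw.
  have dz : dom a z by exists w.
  have dw : dom b w by exists u.
  rewrite /= !inE => /orP[/eqP zx|zX]; last by move: dz; rewrite da /= zX.
  by move: dw; rewrite db /= => -[]; move: az; rewrite zx axy => -[].
rewrite /= !inE => /negP; rewrite negb_or => /andP[zx zX].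
have [w az] : dom a z by rewrite da /=; apply/negP.
have [u bw] : dom b w.
  by rewrite db /= => wy; case/eqP: zx; apply: a_inj az _; rewrite wy.
by exists u; apply: etrans (IO_mul_Some _ az) bw.
Qed.

Lemma greenD_total a b : has_full_ranges -> greenD a b.
Proof.
move=> full.
have [p [dp rp]] : exists p : IO_infty T, dom p = dom b /\ ran p = setT.
  by apply: full; apply: dom_IO.
have [q [dq rq]] : exists q : IO_infty T, dom q = ran a /\ ran q = setT.
  by apply: full; case: (IO_funP a).
(* This product has the domain of [b] and the range of [a]. *)
exists (p * IO_inv q); first by apply/greenL_ran; rewrite ran_mul_full // ran_IO_inv.
by apply/greenR_dom; rewrite dom_mul_full // dom_IO_inv.
Qed.

Lemma infinite_idem_factor (u v : nat -> IO_infty T) e f :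
  has_full_ranges -> injective u ->
  (forall k, u k * v k = 1) -> (forall k, v k * u k = 1) ->
  idempotents (IO_infty T) e -> idempotents (IO_infty T) f ->
  infinite_set [set a : IO_infty T | exists b, a * b = e /\ b * a = f] /\
  infinite_set [set b : IO_infty T | exists a, a * b = e /\ b * a = f].
Proof.
move=> full u_inj uv vu ie jf.
have [p [dp rp]] := full _ (dom_IO e); have [q [dq rq]] := full _ (dom_IO f).
have inv1 (c : IO_infty T) : ran c = setT -> IO_inv c * c = 1.
  by move=> rc; rewrite -[LHS]mul1g mulgA mulVg_ran // rc.
have inve (c g : IO_infty T) : idempotents (IO_infty T) g -> dom c = dom g -> c * IO_inv c = g.
  move=> ig cg; apply: idem_eq => //; last by rewrite dom_mulV.
  by rewrite /idempotents /= -mulgA mulVg_dom // dom_mulV.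
have pV := inv1 p rp; have qV := inv1 q rq.
have pe := inve p e ie dp; have qf := inve q f jf dq.
pose a k := p * u k * IO_inv q; pose b k := q * v k * IO_inv p.
have ab k : a k * b k = e.
  rewrite /a /b -!mulgA (mulgA (IO_inv q)) qV mul1g (mulgA (u k)) uv mul1g.
  exact: pe.
have ba k : b k * a k = f.
  rewrite /a /b -!mulgA (mulgA (IO_inv p)) pV mul1g (mulgA (v k)) vu mul1g.
  exact: qf.
(* Multiplying by [IO_inv p] on the left and [q] on the right recovers [u k]. *)
have a_inj : injective a.
  move=> k l /(congr1 (fun c : IO_infty T => IO_inv p * c * q)); rewrite /a.
  by rewrite !mulgA pV !mul1g -!mulgA qV !mulg1 => /u_inj.
(* The same cancellation recovers [v k], which determines its two-sided inverse [u k]. *)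
have b_inj : injective b.
  move=> k l /(congr1 (fun c : IO_infty T => IO_inv q * c * p)); rewrite /b.
  rewrite !mulgA qV !mul1g -!mulgA pV !mulg1 => kl; apply: u_inj.
  by rewrite -[u k]mulg1 -(vu l) mulgA -kl uv mul1g.
split; [apply: injective_infinite_set a_inj _|
        apply: injective_infinite_set b_inj _] => k.
  by exists (b k).
by exists (a k).
Qed.

End Expansion.

(** * Shifts and point removals in the lexicographic product *)

Section LexPowerOfZ.
Context {n : nat}.
Implicit Types p q x : LnZ n.

(** Reduces the order to arithmetic comparisons that [lia] can decide. *)
Lemma le_lexE p q :
  (p <= q)%O = (p.1 < q.1)%N || (p.1 == q.1) && (p.2 <= q.2)%R.
Proof.
rewrite Order.ProdLexiOrder.leEprodlexi !leEord -val_eqE /=.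
by case: ltngtP.
Qed.

Definition shift (k : int) p : option (LnZ n) := Some (p.1, p.2 + k)%R.

Lemma cofinite_monotone_shift k : cofinite_monotone (shift k).
Proof.
split.
- by move=> [i s] [j t] z [<-] [-> /GRing.addIr ->].
- move=> [i s] [j t] _ _ [<-] [<-]; rewrite !le_lexE /=; lia.
- by apply: (sub_finite_set _ (finite_set0 _)) => p; apply; eexists.
- apply: (sub_finite_set _ (finite_set0 _)) => -[i s]; apply.
  by exists (i, s - k)%R; rewrite /shift GRing.subrK.
Qed.

Definition IO_shift k : IOZlex n := MkIO (cofinite_monotone_shift k).

Lemma IO_shiftN k : IO_shift k * IO_shift (- k) = 1.
Proof. by apply: IO_eq => -[i s]; rewrite /= /shift /pcomp /= GRing.addrK. Qed.

Definition remove_point x p : option (LnZ n) :=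
  if p == x then None
  else Some (p.1, if (p.1 == x.1) && (x.2 < p.2)%R then (p.2 - 1)%R else p.2).

Lemma dom_remove_point x : dom (remove_point x) = ~` [set x].
Proof.
apply/seteqP; split=> [p [q]|p /eqP /negPf px].
  by rewrite /remove_point; case: eqP.
by rewrite /remove_point /dom /= px; eexists.
Qed.

Lemma ran_remove_point x : ran (remove_point x) = setT.
Proof.
apply/seteqP; split=> // -[i m] _; case: x => j l.
(* Points at or above the removed point in its own copy of the integers come from one step higher,
   so the preimage is never the removed point. *)
exists (i, if (i == j) && (l <= m)%R then (m + 1)%R else m).
rewrite /remove_point /= xpair_eqE; case: eqP => //= _.
have [lm|ml] := leP l m.
  by rewrite ifF; [rewrite ifT; [rewrite GRing.addrK|lia]|lia].
by rewrite ifF; [rewrite ifF //; lia|lia].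
Qed.

Lemma cofinite_monotone_remove_point x : cofinite_monotone (remove_point x).
Proof.
split; last first.
- by rewrite ran_remove_point setCT; exact: finite_set0.
- by rewrite dom_remove_point setCK; exact: finite_set1.
- move=> [i s] [j t] u v; rewrite /remove_point.
  case: ifP => // _ [<-]; case: ifP => // _ [<-]; rewrite !le_lexE /= -!val_eqE /=.
  by do 2 case: ifP; lia.
- move=> [i s] [j t] z; rewrite /remove_point.
  case: ifP => // h1 [<-]; case: ifP => // h2 [ji st].
  (* The only possible collision is between [r] and [r + 1] in the copy [k]; it is excluded because
     [r] is removed. *)
  move: h1 h2 st; case: x => k r; rewrite !xpair_eqE -ji /=.
  by do 2 case: ifP; rewrite -!val_eqE => *; congr (_, _); lia.
Qed.

Lemma LnZ_full_ranges : @has_full_ranges _ (LnZ n).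
Proof.
apply: remove_points_full_ranges => x.
by exists (MkIO (cofinite_monotone_remove_point x)); rewrite /= dom_remove_point ran_remove_point.
Qed.

End LexPowerOfZ.

Theorem proposition2p4 (n : nat) (n_gt0 : (0 < n)%N) :
  (* (i) *)
  (forall a : IOZlex n,
     idempotents (IOZlex n) a <-> (forall x, dom a x -> a x = Some x)) /\
  (* (ii) *)
  (forall e i : IOZlex n,
     idempotents (IOZlex n) e -> idempotents (IOZlex n) i ->
     (idem_le e i <-> dom e `<=` dom i)) /\
  (* (iii) *)
  semilattice_iso (idempotents (IOZlex n)) (fun e i => e * i)
    [set A : set (LnZ n) | finite_set A] (fun A B => A `|` B)
    (fun e => ~` dom e) /\
  (* (iv) *)
  (forall C : set (IOZlex n), is_maximal_chain C -> is_omega_chain C) /\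
  (* (v) *)
  (forall a b : IOZlex n, greenR a b <-> dom a = dom b) /\
  (* (vi) *)
  (forall a b : IOZlex n, greenL a b <-> ran a = ran b) /\
  (* (vii) *)
  (forall a b : IOZlex n, greenH a b <-> dom a = dom b /\ ran a = ran b) /\
  (* (viii) *)
  (forall e f : IOZlex n,
     idempotents (IOZlex n) e -> idempotents (IOZlex n) f ->
     infinite_set [set a : IOZlex n | exists b, a * b = e /\ b * a = f] /\
     infinite_set [set b : IOZlex n | exists a, a * b = e /\ b * a = f]) /\
  (* (ix) *)
  bisimple (IOZlex n) /\
  (forall a b : IOZlex n, greenJ a b <-> greenD a b).
Proof.
(* A copy of the integers exists because [n] is positive; it makes the underlying set infinite and
   tells the shifts apart. *)
have z : 'I_n := Ordinal n_gt0.
have infT : infinite_set [set: LnZ n].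
  by apply: (@injective_infinite_set _ (fun k => (z, Posz k))) => // k l [].
split; first exact: idempotentP.
split; first exact: idem_dom_le.
split; first exact: idempotents_iso.
split; first by move=> C; apply: maximal_chain_omega.
split; first exact: greenR_dom.
split; first exact: greenL_ran.
split; first exact: greenH_dom_ran.
have D (a b : IOZlex n) : greenD a b by apply: greenD_total; exact: LnZ_full_ranges.
split=> [e f ie jf|].
  apply: (infinite_idem_factor (u := fun k => IO_shift (Posz k))
    (v := fun k => IO_shift (- Posz k)%R) LnZ_full_ranges _ _ _ ie jf).
  (* A shift is determined by its value at the origin of the copy [z]. *)
  - by move=> k l /(congr1 (fun a : IOZlex n => a (z, 0%R))) []; lia.
  - by move=> k; apply: IO_shiftN.
  - by move=> k; rewrite -[X in _ * IO_shift X]GRing.opprK IO_shiftN.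
split; first exact: greenD_total_bisimple (1 : IOZlex n) D.
(* The implication from [greenJ] to [greenD] is immediate, since [greenD] is universal. *)
by move=> a b; split=> // /greenD_J.
Qed.
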